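(* Let $A$ carry an IF-structure in a strict symmetric monoidal $\dagger$-category $\mathcal{C}$, together with groups $G_K$ of green phases and $H_K$ of red phases satisfying the IFK equations, and suppose $A$ has enough green-set-like elements with respect to $H_K$. Suppose $H_K$ is finite with exponent $d$. Then the internal integers form the finite ring $\mathbb{Z}_d$; that is, $\mathbf{n}=\mathbf{m}$ whenever $n\equiv m \pmod d$.
   Context: Work in a strict symmetric monoidal $\dagger$-category (unit $I$, symmetry $\sigma$, $\dagger$ involutive identity-on-objects contravariant, compatible with $\otimes$). A $\dagger$-SCFA on $A$ is $(\mu,\eta,\delta=\mu^\dagger,\epsilon=\eta^\dagger)$ with $(\mu,\eta)$ a commutative monoid, $(\mu\otimes\mathrm{id})(\mathrm{id}\otimes\delta)=\delta\mu=(\mathrm{id}\otimes\mu)(\delta\otimes\mathrm{id})$, and $\mu\delta=\mathrm{id}_A$. An IF-structure on $A$ is a pair of $\dagger$-SCFAs, green $(\mu_g,\eta_g,\delta_g,\epsilon_g)$ and red $(\mu_r,\eta_r,\delta_r,\epsilon_r)$, such that $\delta_g\mu_r=(\mu_r\otimes\mu_r)(\mathrm{id}\otimes\sigma\otimes\mathrm{id})(\delta_g\otimes\delta_g)$, $\delta_g\eta_r=\eta_r\otimes\eta_r$, $\epsilon_g\mu_r=\epsilon_g\otimes\epsilon_g$, and $\eta_r=(\epsilon_r\otimes\mathrm{id}_A)\delta_g\eta_g$, $\epsilon_g=\epsilon_r\mu_r(\mathrm{id}_A\otimes\eta_g)$; scalar factors built from $\epsilon_g\eta_r$ accompanying the bialgebra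 laws are suppressed throughout (and $\epsilon_g\eta_r=\mathrm{id}_I$ is not imposed). For a colour $c$, a $c$-phase is a unitary $\alpha:A\to A$ with $\mu_c\circ(\alpha\otimes\mathrm{id}_A)=\alpha\circ\mu_c$; a point $\psi:I\to A$ is $c$-set-like if $\delta_c\circ\psi=\psi\otimes\psi$. IFK equations: $G_K$ is a group (under composition) of green phases such that $g\circ\eta_g$ is red-set-like for each $g\in G_K$, and $H_K$ is a group of red phases such that $h\circ\eta_r$ is green-set-like for each $h\in H_K$. Enough green-set-like elements: for all objects $B$ and $f,f':A\to B$, if $f\circ h\circ\eta_r=f'\circ h\circ\eta_r$ for all $h\in H_K$ then $f=f'$. Internal integers: $\mathbf{0}:=\eta_r\circ\epsilon_g$ and $\mathbf{n+1}:=\mu_r\circ(\mathbf{n}\otimes\mathrm{id}_A)\circ\delta_g$ for $n\in\mathbb{N}$; these form a ring under the convolution sum $f+f':=\mu_r\circ(f\otimes f')\circ\delta_g$ and composition. The exponent of a finite group is the least positive $d$ with $x^d=e$ for all $x$. *)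

(* Defs.v *)
From mathcomp Require Import all_boot.
From mathcomp Require Import boolp classical_sets cardinality.

Set Implicit Arguments.
Unset Strict Implicit.
Unset Printing Implicit Defensive.

Declare Scope cat_scope.
Delimit Scope cat_scope with cat.
Local Open Scope classical_set_scope.
Local Open Scope cat_scope.

Record category := Category {
  obj :> Type;
  hom : obj -> obj -> Type;
  idm : forall A, hom A A;
  compm : forall A B C, hom B C -> hom A B -> hom A C;
  comp1m : forall A B (f : hom A B), compm (idm B) f = f;
  compm1 : forall A B (f : hom A B), compm f (idm A) = f;
  compmA : forall A B C D (h : hom C D) (g : hom B C) (f : hom A B),
    compm h (compm g f) = compm (compm h g) f
}.
Arguments hom {c} A B.
Arguments idm {c} A.
Arguments compm {c A B C} g f.
Notation "g ∘ f" := (compm g f)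
  (at level 40, left associativity) : cat_scope.

(* The identity morphism of X, retyped along an equality of objects.  In a
   strict monoidal category the associators and unitors are of this form;
   object equality being proof-irrelevant (propositional extensionality),
   [coe e] depends only on its source and target. *)
Definition coe (C : category) (X Y : C) (e : X = Y) : hom X Y :=
  match e in _ = Z return hom X Z with erefl => idm X end.

Record strictMonoidal := StrictMonoidal {
  mcat :> category;
  munit : mcat;
  tens : mcat -> mcat -> mcat;
  tensm : forall (A B A' B' : mcat),
    hom A B -> hom A' B' -> hom (tens A A') (tens B B');
  tensm1 : forall A B : mcat, tensm (idm A) (idm B) = idm (tens A B);
  tensm_comp : forall (A B C A' B' C' : mcat)
    (g : hom B C) (f : hom A B) (g' : hom B' C') (f' : hom A' B'),
    tensm (g ∘ f) (g' ∘ f') = tensm g g' ∘ tensm f f';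
  tensA : forall A B C : mcat, tens (tens A B) C = tens A (tens B C);
  tens1o : forall A : mcat, tens munit A = A;
  tenso1 : forall A : mcat, tens A munit = A;
  tensmA : forall (A B C A' B' C' : mcat)
    (f : hom A A') (g : hom B B') (h : hom C C'),
    coe (tensA A' B' C') ∘ tensm (tensm f g) h
    = tensm f (tensm g h) ∘ coe (tensA A B C);
  tens1m : forall (A B : mcat) (f : hom A B),
    coe (tens1o B) ∘ tensm (idm munit) f = f ∘ coe (tens1o A);
  tensmo1 : forall (A B : mcat) (f : hom A B),
    coe (tenso1 B) ∘ tensm f (idm munit) = f ∘ coe (tenso1 A)
}.
Arguments munit {s}.
Arguments tens {s} A B.
Arguments tensm {s A B A' B'} f g.
Notation "A ⊗ B" := (tens A B) (at level 35, right associativity) : cat_scope.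
Notation "f ⊠ g" := (tensm f g) (at level 35, right associativity) : cat_scope.

Definition asc (C : strictMonoidal) (X Y Z : C) :
  hom ((X ⊗ Y) ⊗ Z) (X ⊗ (Y ⊗ Z)) := coe (tensA X Y Z).
Definition asc' (C : strictMonoidal) (X Y Z : C) :
  hom (X ⊗ (Y ⊗ Z)) ((X ⊗ Y) ⊗ Z) := coe (esym (tensA X Y Z)).
Definition lun (C : strictMonoidal) (X : C) :
  hom (munit ⊗ X) X := coe (tens1o X).
Definition lun' (C : strictMonoidal) (X : C) :
  hom X (munit ⊗ X) := coe (esym (tens1o X)).
Definition run (C : strictMonoidal) (X : C) :
  hom (X ⊗ munit) X := coe (tenso1 X).
Definition run' (C : strictMonoidal) (X : C) :
  hom X (X ⊗ munit) := coe (esym (tenso1 X)).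

Record symDaggerCat := SymDaggerCat {
  smcat :> strictMonoidal;
  sym : forall A B : smcat, hom (A ⊗ B) (B ⊗ A);
  sym_nat : forall (A B A' B' : smcat) (f : hom A B) (f' : hom A' B'),
    sym B B' ∘ (f ⊠ f') = (f' ⊠ f) ∘ sym A A';
  symK : forall A B : smcat, sym B A ∘ sym A B = idm (A ⊗ B);
  sym_hexagon : forall A B C : smcat,
    asc B C A ∘ sym A (B ⊗ C) ∘ asc A B C
    = (idm B ⊠ sym A C) ∘ asc B A C ∘ (sym A B ⊠ idm C);
  dag : forall A B : smcat, hom A B -> hom B A;
  dagK : forall (A B : smcat) (f : hom A B), dag (dag f) = f;
  dag1 : forall A : smcat, dag (idm A) = idm A;
  dag_comp : forall (A B C : smcat) (g : hom B C) (f : hom A B),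
    dag (g ∘ f) = dag f ∘ dag g;
  dag_tens : forall (A B A' B' : smcat) (f : hom A B) (f' : hom A' B'),
    dag (f ⊠ f') = dag f ⊠ dag f';
  dag_sym : forall A B : smcat, dag (sym A B) = sym B A
}.
Arguments sym {s} A B.
Arguments dag {s A B} f.
Notation "f '^†'" := (dag f) (at level 2, left associativity, format "f '^†'")
  : cat_scope.

(* id ⊗ σ ⊗ id *)
Definition midswap (C : symDaggerCat) (X Y Z W : C) :
  hom ((X ⊗ Y) ⊗ (Z ⊗ W)) ((X ⊗ Z) ⊗ (Y ⊗ W)) :=
  asc' X Z (Y ⊗ W)
  ∘ (idm X ⊠ (asc Z Y W ∘ (sym Y Z ⊠ idm W) ∘ asc' Y Z W))
  ∘ asc X Y (Z ⊗ W).

Definition unitary (C : symDaggerCat) (A B : C) (f : hom A B) : Prop :=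
  f^† ∘ f = idm A /\ f ∘ f^† = idm B.

Record daggerSCFA (C : symDaggerCat) (A : C) := DaggerSCFA {
  mu : hom (A ⊗ A) A;
  eta : hom munit A;
  mu_assoc : mu ∘ (mu ⊠ idm A) = mu ∘ (idm A ⊠ mu) ∘ asc A A A;
  mu_unitl : mu ∘ (eta ⊠ idm A) ∘ lun' A = idm A;
  mu_unitr : mu ∘ (idm A ⊠ eta) ∘ run' A = idm A;
  mu_comm : mu ∘ sym A A = mu;
  frobl : (mu ⊠ idm A) ∘ asc' A A A ∘ (idm A ⊠ mu^†) = mu^† ∘ mu;
  frobr : (idm A ⊠ mu) ∘ asc A A A ∘ (mu^† ⊠ idm A) = mu^† ∘ mu;
  special : mu ∘ mu^† = idm A
}.

Definition delta (C : symDaggerCat) (A : C) (c : daggerSCFA A) :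
  hom A (A ⊗ A) := (mu c)^†.
Definition eps (C : symDaggerCat) (A : C) (c : daggerSCFA A) :
  hom A munit := (eta c)^†.

(* The laws hold on the nose, without scalar factors;
   eps green ∘ eta red = idm munit is not required. *)
Record IFstructure (C : symDaggerCat) (A : C) := IFStructure {
  green : daggerSCFA A;
  red : daggerSCFA A;
  bialg : delta green ∘ mu red
    = (mu red ⊠ mu red) ∘ midswap A A A A ∘ (delta green ⊠ delta green);
  copy_unit : delta green ∘ eta red = (eta red ⊠ eta red) ∘ lun' munit;
  counit_mul : eps green ∘ mu red = lun munit ∘ (eps green ⊠ eps green);
  eta_redE : eta red
    = lun A ∘ (eps red ⊠ idm A) ∘ delta green ∘ eta green;
  eps_greenE : eps green
    = eps red ∘ mu red ∘ (idm A ⊠ eta green) ∘ run' A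
}.

Definition phase (C : symDaggerCat) (A : C) (c : daggerSCFA A)
    (a : hom A A) : Prop :=
  unitary a /\ mu c ∘ (a ⊠ idm A) = a ∘ mu c.

Definition set_like (C : symDaggerCat) (A : C) (c : daggerSCFA A)
    (psi : hom munit A) : Prop :=
  delta c ∘ psi = (psi ⊠ psi) ∘ lun' munit.

Definition comp_group (C : category) (A : C) (G : set (hom A A)) : Prop :=
  [/\ G (idm A),
      forall a b, G a -> G b -> G (a ∘ b)
    & forall a, G a -> exists2 b, G b & a ∘ b = idm A /\ b ∘ a = idm A].

Definition phase_group (C : symDaggerCat) (A : C) (c : daggerSCFA A)
    (G : set (hom A A)) : Prop :=
  comp_group G /\ (forall a, G a -> phase c a).

Definition IFK (C : symDaggerCat) (A : C) (F : IFstructure A)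
    (GK HK : set (hom A A)) : Prop :=
  [/\ phase_group (green F) GK,
      forall g, GK g -> set_like (red F) (g ∘ eta (green F)),
      phase_group (red F) HK
    & forall h, HK h -> set_like (green F) (h ∘ eta (red F))].

Definition enough_green_set_like (C : symDaggerCat) (A : C)
    (F : IFstructure A) (HK : set (hom A A)) : Prop :=
  forall (B : C) (f f' : hom A B),
    (forall h, HK h -> f ∘ h ∘ eta (red F) = f' ∘ h ∘ eta (red F)) ->
    f = f'.

Definition expm (C : category) (A : C) (a : hom A A) (n : nat) : hom A A :=
  iter n (compm a) (idm A).

Definition is_exponent (C : category) (A : C) (G : set (hom A A)) (d : nat) :
    Prop :=
  [/\ (0 < d)%N, forall x, G x -> expm x d = idm A
    & forall e, (0 < e)%N -> (forall x, G x -> expm x e = idm A) -> (d <= e)%N].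

Definition convsum (C : symDaggerCat) (A : C) (F : IFstructure A)
    (f f' : hom A A) : hom A A :=
  mu (red F) ∘ (f ⊠ f') ∘ delta (green F).

Fixpoint intint (C : symDaggerCat) (A : C) (F : IFstructure A) (n : nat) :
    hom A A :=
  if n is n'.+1 then mu (red F) ∘ (intint F n' ⊠ idm A) ∘ delta (green F)
  else eta (red F) ∘ eps (green F).

(* Main.v *)
Require Import Defs.
From mathcomp Require Import all_boot.
From mathcomp Require Import boolp classical_sets cardinality.

Set Implicit Arguments.
Unset Strict Implicit.
Unset Printing Implicit Defensive.

Local Open Scope cat_scope.

                                                                              
                                                                               
                                                                               
                                                                          
                                                                      

(** The integer [intint F n] acts on the points [h ∘ eta (red F)], [h] in [HK], as the [n]-th power
    map [h] to [h^n]. Indeed such a point is copied by the green comultiplication, and multiplying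
    by it in red is applying the phase [h], so convolution of endomorphisms becomes, on these
    points, composition of phases ([convsum_phase], [intint_point]). Enough green-set-like elements
    make an endomorphism of [A] determined by this action, and a red phase is determined by its
    value at the red unit ([phase_inj]). Hence two integers agree exactly when the power maps agree
    on [HK], that is, modulo the exponent ([exponent_eq_mod]); sums and products of integers follow
    from the laws of exponents. *)

Section Powers.
Variables (C : category) (A : C).
Implicit Types (a b : hom A A) (G : set (hom A A)).

Lemma expmS a n : expm a n.+1 = a ∘ expm a n.
Proof. by []. Qed.

Lemma expmD a n m : expm a (n + m) = expm a n ∘ expm a m.
Proof.
elim: n => [|n IHn]; first by rewrite comp1m.
by rewrite addSn !expmS IHn compmA.
Qed.

Lemma expm_id n : expm (idm A) n = idm A.
Proof. by elim: n => [//|n IHn]; rewrite expmS IHn comp1m. Qed.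

Lemma expmM a n m : expm a (n * m) = expm (expm a n) m.
Proof. by elim: m => [|m IHm]; rewrite ?muln0 // mulnS expmD IHm expmS. Qed.

Lemma comp_group_expm G a n : comp_group G -> G a -> G (expm a n).
Proof.
by case=> G1 GM _ Ga; elim: n => [//|n IHn]; rewrite expmS; apply: GM.
Qed.

Lemma expm_cancel a b n m : a ∘ b = idm A -> expm a n = expm a (n + m) ->
  expm a m = idm A.
Proof.
move=> ab; elim: n => [|n IHn] eq_nm; first by rewrite -[m]add0n -eq_nm.
apply: IHn; move: eq_nm; rewrite -addn1 addnAC !expmD expmS compm1.
by move=> /(congr1 (compm^~ b)); rewrite -!compmA ab !compm1 -expmD.
Qed.

Lemma expm_mod a d n : expm a d = idm A -> expm a (n %% d) = expm a n.
Proof.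
move=> ad1; rewrite {2}(divn_eq n d) expmD mulnC expmM ad1.
by rewrite expm_id comp1m.
Qed.

Lemma exponent_dvd G d n : is_exponent G d ->
  (forall x, G x -> expm x n = idm A) -> d %| n.
Proof.
(* The remainder of [n] by [d] also annihilates [G]; were it positive, it would contradict the
   minimality of [d]. *)
move=> [d_gt0 Gd d_min] Gn; rewrite /dvdn eqn0Ngt; apply/negP => r_gt0.
have := ltn_pmod n d_gt0; rewrite ltnNge => /negP; apply.
by apply: d_min => // x Gx; rewrite (expm_mod _ (Gd x Gx)) Gn.
Qed.

Lemma exponent_eq_mod G d n m : comp_group G -> is_exponent G d ->
  (forall x, G x -> expm x n = expm x m) -> n = m %[mod d].
Proof.
move=> [_ _ GV] Gd; wlog le_nm : n m / n <= m => [IH | Gnm].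
  by case/orP: (leq_total n m) => /IH // IH' Gnm; apply/esym/IH' => x /Gnm.
apply/esym/eqP; rewrite eqn_mod_dvd //; apply: (exponent_dvd Gd) => x Gx.
have [y _ [xy _]] := GV x Gx.
by apply: (expm_cancel xy (n := n)); rewrite subnKC // Gnm.
Qed.

End Powers.

Section StrictUnit.
Variable C : symDaggerCat.
Implicit Types X Y : C.

Lemma coeK {X Y : C} (e : X = Y) : coe (esym e) ∘ coe e = idm X.
Proof. by case: _ / e; rewrite comp1m. Qed.

Lemma coe_symK {X Y : C} (e : X = Y) : coe e ∘ coe (esym e) = idm Y.
Proof. by case: _ / e; rewrite comp1m. Qed.

Lemma dag_coe {X Y : C} (e : X = Y) : dag (coe e) = coe (esym e).
Proof. by case: _ / e; rewrite dag1. Qed.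

Lemma lun'_nat {X Y : C} (f : hom X Y) :
  (idm munit ⊠ f) ∘ lun' X = lun' Y ∘ f.
Proof.
have := congr1 (fun g => lun' Y ∘ g ∘ lun' X) (@tens1m C X Y f).
by rewrite /lun' !compmA coeK comp1m -!compmA coe_symK compm1.
Qed.

(** Both unitors retype along proofs of one and the same equality of objects, and such proofs are
    all equal. *)
Lemma lun_munit : lun munit = run munit :> hom (munit ⊗ munit) (munit : C).
Proof. by congr (coe _); apply: Prop_irrelevance. Qed.

Lemma scalar_tens (s : hom munit (munit : C)) :
  lun munit ∘ (s ⊠ idm munit) ∘ lun' munit = s.
Proof.
rewrite lun_munit /run tensmo1 -[coe (tenso1 _)]/(run munit) -lun_munit.
by rewrite -compmA coe_symK compm1.
Qed.

End StrictUnit.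

Section Points.
Variables (C : symDaggerCat) (A : C).
Implicit Types (c : daggerSCFA A) (a : hom A A) (psi : hom munit A).

Lemma delta_counitl c : lun A ∘ (eps c ⊠ idm A) ∘ delta c = idm A.
Proof.
have := congr1 dag (mu_unitl c).
by rewrite !dag_comp dag_tens !dag1 dag_coe esymK compmA.
Qed.

(** The phase slides out of the multiplication, leaving the unit to be absorbed. *)
Lemma phase_mu_point c a psi : phase c a ->
  mu c ∘ ((a ∘ eta c) ⊠ psi) ∘ lun' munit = a ∘ psi.
Proof.
move=> [_ a_mu].
have -> : (a ∘ eta c) ⊠ psi
    = (a ⊠ idm A) ∘ ((eta c ⊠ idm A) ∘ (idm munit ⊠ psi)).
  by rewrite -!tensm_comp !comp1m compm1.
rewrite compmA a_mu -!compmA lun'_nat [eta c ⊠ _ ∘ _]compmA.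
by rewrite [mu c ∘ _]compmA [mu c ∘ _]compmA mu_unitl comp1m.
Qed.

(** A phase is multiplication by its own value at the unit. *)
Lemma phase_inj c a b : phase c a -> phase c b ->
  a ∘ eta c = b ∘ eta c -> a = b.
Proof.
have phaseE x : phase c x -> x = mu c ∘ ((x ∘ eta c) ⊠ idm A) ∘ lun' A.
  move=> [_ x_mu]; rewrite -[idm A]comp1m tensm_comp compmA x_mu -!compmA.
  by rewrite [mu c ∘ _]compmA mu_unitl compm1.
by move=> /phaseE aE /phaseE bE eq_ab; rewrite aE bE eq_ab.
Qed.

(** Copy [psi], then erase one copy by the counit: this costs the scalar [eps c ∘ psi], which need
    not be the identity but is absorbed by [psi]. *)
Lemma set_like_scalar c psi : set_like c psi -> psi ∘ (eps c ∘ psi) = psi.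
Proof.
move=> psi_copy; rewrite -{3}[psi]comp1m -(delta_counitl c).
rewrite -[RHS]compmA psi_copy [RHS]compmA.
rewrite -[lun A ∘ _ ∘ _]compmA -tensm_comp comp1m.
have -> : (eps c ∘ psi) ⊠ psi
    = (idm munit ⊠ psi) ∘ ((eps c ∘ psi) ⊠ idm munit).
  by rewrite -tensm_comp comp1m compm1.
rewrite [lun A ∘ _]compmA /lun tens1m -[coe _]/(lun munit) -!compmA.
by congr (_ ∘ _); rewrite [RHS]compmA scalar_tens.
Qed.

Lemma convsum_set_like (F : IFstructure A) (f f' : hom A A) psi :
  set_like (green F) psi ->
  convsum F f f' ∘ psi = mu (red F) ∘ ((f ∘ psi) ⊠ (f' ∘ psi)) ∘ lun' munit.
Proof.
move=> psi_copy; rewrite /convsum -compmA psi_copy compmA.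
by rewrite -[_ ∘ (f ⊠ f') ∘ _]compmA -tensm_comp.
Qed.

(** Serves both the successor step of [intint_point] and the additivity of the integers. *)
Lemma convsum_phase (F : IFstructure A) (f f' a b : hom A A) psi :
  set_like (green F) psi -> phase (red F) a ->
  f ∘ psi = a ∘ eta (red F) -> f' ∘ psi = b ∘ eta (red F) ->
  convsum F f f' ∘ psi = (a ∘ b) ∘ eta (red F).
Proof.
move=> psi_copy a_ph fE f'E.
by rewrite convsum_set_like // fE f'E phase_mu_point // compmA.
Qed.

End Points.

Section InternalIntegers.
Variables (C : symDaggerCat) (A : C) (F : IFstructure A) (HK : set (hom A A)).
Hypothesis HK_ph : phase_group (red F) HK.
Hypothesis HK_copy : forall h, HK h -> set_like (green F) (h ∘ eta (red F)).

Lemma HK_phase_expm h n : HK h -> phase (red F) (expm h n).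
Proof. by case: HK_ph => HKg ph Hh; apply: ph; apply: comp_group_expm. Qed.

Lemma intint_point n h : HK h ->
  intint F n ∘ (h ∘ eta (red F)) = expm h n ∘ eta (red F).
Proof.
move=> Hh; elim: n => [|n IHn] /=.
                                                                          
  (* Zero leaves the scalar [eps (green F) ∘ h ∘ eta (red F)] beside the red unit. The point
     [h ∘ eta (red F)] absorbs it, and stripping the unitary [h] shows that [eta (red F)] does
     too. *)
  have /(congr1 (compm (dag h))) := set_like_scalar (HK_copy Hh).
  have [[hVh _] _] := HK_ph.2 _ Hh.
  by rewrite -[in LHS]compmA !compmA hVh !comp1m.
rewrite -[mu _ ∘ _ ∘ _]/(convsum F (intint F n) (idm A)).
rewrite (convsum_phase (a := expm h n) (b := h)) ?comp1m //.
- by rewrite -expmS -addn1 expmD [expm h 1]compm1.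
- exact: HK_copy.
- exact: HK_phase_expm.
Qed.

End InternalIntegers.

Theorem theorem11 (C : symDaggerCat) (A : C) (F : IFstructure A)
    (GK HK : set (hom A A)) (d : nat)
    (hIFK : IFK F GK HK)
    (hpts : enough_green_set_like F HK)
    (hfin : finite_set HK)
    (hexp : is_exponent HK d) :
  (forall n m : nat, intint F n = intint F m <-> n = m %[mod d]) /\
  [/\ intint F 1 = idm A,
      forall n m : nat, convsum F (intint F n) (intint F m) = intint F (n + m)
    & forall n m : nat, intint F n ∘ intint F m = intint F (n * m)].
Proof.
case: hIFK => _ _ HK_ph HK_copy.
have HKg := HK_ph.1.
have pointE := intint_point HK_ph HK_copy.
have phE := HK_phase_expm HK_ph.
have ext f f' : (forall h, HK h ->
    f ∘ (h ∘ eta (red F)) = f' ∘ (h ∘ eta (red F))) -> f = f'.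
  by move=> eq_ff'; apply: hpts => h Hh; rewrite -!compmA eq_ff'.
split=> [n m|]; first split=> [eq_nm | eq_nm].
- apply: (exponent_eq_mod HKg hexp) => h Hh.
  apply: (phase_inj (phE h n Hh) (phE h m Hh)).
  by rewrite -!pointE // eq_nm.
(* On each point only [h^n] matters, and it depends only on [n] modulo [d]. *)
- apply: ext => h Hh; have [_ Hd _] := hexp.
  rewrite !pointE // -(@expm_mod _ _ _ d n) ?Hd // eq_nm.
  by rewrite expm_mod ?Hd.
split=> [|n m|n m]; apply: ext => h Hh.
- by rewrite pointE // [expm h 1]compm1 comp1m.
- rewrite pointE // expmD; apply: convsum_phase => //; last 2 first.
  + exact: pointE.
  + exact: pointE.
  + exact: HK_copy.
  + exact: phE.
(* The point reached by the inner integer comes from [h^m], again in [HK], so the outer integer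
   raises it to the power [n]. *)
- by rewrite -compmA !pointE //; [rewrite mulnC expmM | apply: comp_group_expm].
Qed.
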